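(* Let $G$ be an infinite, connected, bipartite graph with vertex classes coloured black and white, such that the coloured graph is quasi-transitive and every vertex has degree $3$. Let $\phi_1,\phi_2$ be local transformations, and let $\widetilde G$ be obtained from $G$ by applying $\phi_1$ at each black vertex and $\phi_2$ at each white vertex (assumed connected). Then the connective constants $\mu=\mu(G)$ and $\widetilde\mu=\mu(\widetilde G)$ satisfy \[ \mu^{-2}=g_{\phi_1}(\widetilde\mu^{-1})\,g_{\phi_2}(\widetilde\mu^{-1}). \]
   Context: All graphs are simple. For a bipartite graph with a colouring $\chi$ of its two classes, the coloured-automorphism group consists of graph automorphisms preserving colours; the coloured graph is quasi-transitive if there is a finite $W\subseteq V$ such that for every vertex $v$ some coloured automorphism $\alpha$ has $\alpha v\in W$. The connective constant of a quasi-transitive graph is $\mu=\lim_n\sigma_n(v)^{1/n}$, $\sigma_n(v)$ the number of $n$-step self-avoiding walks from $v$. Local transformation: a local transformation $\phi$ acts at a degree-$3$ vertex $v$ of a simple graph by replacing $v$ with a finite connected graph (the gadget) $\phi(v)$ having three distinct distinguished outer vertices (ports) $w_1,w_2,w_3$, each port being attached to exactly one of the three edges formerly incident to $v$ (one port per edge). It is required that (i) all gadgets $\phi(v)$ are isomorphic via isomorphisms sending ports to ports, and (ii) some subgroup of the automorphism group of $\phi(v)$ preserves the set $\{w_1,w_2,w_3\}$ and acts transitively on it. Mid-edge convention: each edge $e$ is identified with a point at its middle. Walks may start and end at mid-edges; such a walk is self-avoiding (a SAW) if it visits no vertex and no mid-edge more than once, and its length $|\pi|$ is the number of vertices it visits.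 Gadget series: for a degree-$3$ vertex $v$ with incident edges $e_1,e_2,e_3$, $g(x)=g_\phi(x)=\sum_{\pi}x^{|\pi|}$, where the sum is over all SAWs $\pi$ that start at the mid-edge of $e_1$, end at the mid-edge of $e_2$, and otherwise visit only vertices of the gadget $\phi(v)$. This polynomial does not depend on $v$ nor on the chosen pair of incident edges. *)

(* Defs.v *)
From Stdlib Require Import Reals.
From mathcomp Require Import all_boot all_fingroup.
From Stdlib Require Lists.List.

Set Implicit Arguments.
Unset Strict Implicit.
Unset Printing Implicit Defensive.

Definition simple_graph (V : Type) (adj : V -> V -> Prop) : Prop :=
  (forall u v, adj u v -> adj v u) /\ (forall v, ~ adj v v).

Definition infinite_type (V : Type) : Prop :=
  ~ exists l : list V, forall v, List.In v l.

Fixpoint adj_chain (V : Type) (adj : V -> V -> Prop) (l : list V) : Prop :=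
  match l with
  | nil => True
  | x :: r =>
      match r with
      | nil => True
      | y :: _ => adj x y /\ adj_chain adj r
      end
  end.

Definition walk (V : Type) (adj : V -> V -> Prop) (u v : V) (l : list V) : Prop :=
  List.hd_error l = Some u /\ List.last l u = v /\ l <> nil /\ adj_chain adj l.

Definition connected_graph (V : Type) (adj : V -> V -> Prop) : Prop :=
  forall u v, exists l, walk adj u v l.

Definition cubic (V : Type) (adj : V -> V -> Prop) : Prop :=
  forall v, exists a b c : V,
    a <> b /\ a <> c /\ b <> c /\
    forall w, adj v w <-> (w = a \/ w = b \/ w = c).

(* proper 2-colouring of the vertex classes (true = black, false = white) *)
Definition bipartite_colouring (V : Type) (adj : V -> V -> Prop)
  (col : V -> bool) : Prop :=
  forall u v, adj u v -> col u <> col v.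

Definition coloured_automorphism (V : Type) (adj : V -> V -> Prop)
  (col : V -> bool) (f : V -> V) : Prop :=
  (exists g : V -> V, (forall x, g (f x) = x) /\ (forall y, f (g y) = y)) /\
  (forall u v, adj u v <-> adj (f u) (f v)) /\
  (forall v, col (f v) = col v).

Definition coloured_quasi_transitive (V : Type) (adj : V -> V -> Prop)
  (col : V -> bool) : Prop :=
  exists W : list V, forall v, exists f,
    coloured_automorphism adj col f /\ List.In (f v) W.

Definition saw (V : Type) (adj : V -> V -> Prop) (n : nat) (v : V)
  (l : list V) : Prop :=
  List.length l = n.+1 /\ List.hd_error l = Some v /\
  adj_chain adj l /\ List.NoDup l.

Definition saw_count (V : Type) (adj : V -> V -> Prop) (n : nat) (v : V)
  (k : nat) : Prop :=
  exists L : list (list V),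
    List.NoDup L /\ (forall l, List.In l L <-> saw adj n v l) /\
    List.length L = k.

Definition connective_constant (V : Type) (adj : V -> V -> Prop) (mu : R)
  : Prop :=
  forall v, exists s : nat -> nat,
    (forall n, saw_count adj n v (s n)) /\
    Un_cv (fun n => Rpower (INR (s n)) (/ INR n)) mu.

Definition gadget (F : finType) (e : rel F) (p : 'I_3 -> F) : Prop :=
  (forall x y, e x y = e y x) /\ (forall x, ~~ e x x) /\
  (forall x y, connect e x y) /\
  injective p /\
  exists H : {group {perm F}},
    (forall s, s \in H ->
       (forall x y, e (s x) (s y) = e x y) /\
       (forall i, exists j, s (p i) = p j)) /\
    (forall i j, exists s, s \in H /\ s (p i) = p j).

Definition gadget_path (F : finType) (e : rel F) (p : 'I_3 -> F)
  (i j : 'I_3) (s : seq F) : bool :=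
  match s with
  | [::] => false
  | x :: r => [&& x == p i, last x r == p j, path e x r & uniq s]
  end.

Definition gadget_path_count (F : finType) (e : rel F) (p : 'I_3 -> F)
  (n : nat) : nat :=
  #|[set t : n.-tuple F | gadget_path e p ord0 (inord 1) t]|.

(* the gadget series g(x) = sum over SAWs pi from mid-edge e_1 to mid-edge
   e_2 (inside the gadget) of x^|pi|, |pi| = number of vertices visited.
   A simple path has at most #|F| vertices. *)
Definition gadget_series (F : finType) (e : rel F) (p : 'I_3 -> F) (x : R)
  : R :=
  sum_f_R0 (fun n => Rmult (INR (gadget_path_count e p n)) (pow x n)) #|F|.

(* lab v u : 'I_3 is the index of the port of the gadget at v to which *)
(* the edge vu is attached.  Black vertices (col = true) get gadget    *)
(* F1, white ones gadget F2.                                           *)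

Definition port_labelling (V : Type) (adj : V -> V -> Prop)
  (lab : V -> V -> 'I_3) : Prop :=
  forall v u w, adj v u -> adj v w -> lab v u = lab v w -> u = w.

Section Transformed.
Variables (V : Type) (adj : V -> V -> Prop) (col : V -> bool).
Variables (F1 F2 : finType) (e1 : rel F1) (e2 : rel F2).
Variables (p1 : 'I_3 -> F1) (p2 : 'I_3 -> F2) (lab : V -> V -> 'I_3).

Definition tvert_ok (x : V * (F1 + F2)) : bool :=
  match x.2 with inl _ => col x.1 | inr _ => ~~ col x.1 end.

Definition tvert : Type := {x : V * (F1 + F2) | tvert_ok x}.

Definition gadget_adj (a b : F1 + F2) : bool :=
  match a, b with
  | inl x, inl y => e1 x y
  | inr x, inr y => e2 x y
  | _, _ => false
  end.

Definition port_at (v : V) (i : 'I_3) : F1 + F2 :=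
  if col v then inl (p1 i) else inr (p2 i).

Definition tadj (a b : tvert) : Prop :=
  let (v, x) := proj1_sig a in
  let (w, y) := proj1_sig b in
  (v = w /\ gadget_adj x y) \/
  (adj v w /\ x = port_at v (lab v w) /\ y = port_at w (lab w v)).

End Transformed.

Arguments tadj [V] adj col [F1 F2] e1 e2 p1 p2 lab a b.

(* Main.v *)
(* Every self-avoiding walk of the transformed graph projects to a walk of the original graph that
   crosses each gadget, apart from its first and last ones, from one port to another. Crossing
   uses two of the three ports, so no gadget is crossed twice and the projection is essentially
   self-avoiding. Conversely a self-avoiding walk of the original graph lifts by choosing a
   port-to-port path in each gadget; by symmetry of the gadgets, their generating function is [g]
   whatever the two ports. Since colours alternate, the generating function at [x] of the walks of
   the transformed graph converges or diverges together with the one of the original graph at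
   [sqrt (g1 x * g2 x)]. Comparing radii of convergence and using the continuity of [g1 * g2]
   gives the identity. *)
Require Import Defs.
From HB Require Import structures.
From Stdlib Require Import Reals Lra.
From mathcomp Require Import all_boot all_order all_fingroup all_algebra boolp Rstruct.

Set Implicit Arguments.
Unset Strict Implicit.
Unset Printing Implicit Defensive.

Import Order.TTheory GRing.Theory Num.Theory.

(** * Weighted sums over lists *)

Section WeightedLists.
Local Open Scope ring_scope.

(** The map [k] reads the index [i] off any entry of [f i], so the lists [f i] are pairwise
    disjoint. *)
Lemma uniq_flatten_map (I T : eqType) (f : I -> seq T) (k : T -> I) (s : seq I) :
  uniq s -> {in s, forall i, uniq (f i)} ->
  {in s, forall i, {in f i, forall y, k y = i}} ->
  uniq (flatten (map f s)).
Proof.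
elim: s => //= i s IHs /andP[i_s s_uniq] f_uniq fK.
rewrite cat_uniq f_uniq ?mem_head //= IHs //; last 2 first.
- by move=> j js; apply: f_uniq; rewrite inE js orbT.
- by move=> j js; apply: fK; rewrite inE js orbT.
rewrite andbT; apply/hasPn => y /flatten_mapP[j js yj]; apply/negP => yi.
have ji : k y = j by apply: fK => //; rewrite inE js orbT.
by rewrite -(fK i _ y yi) ?mem_head // ji js in i_s.
Qed.

(** Repetitions in [B] are allowed: each entry of [A] removes one copy from [B]. Upper bounds can
    thus use redundant covers. *)
Lemma ler_sum_subset (R : numDomainType) (T : eqType) (A B : seq T) (f : T -> R) :
  uniq A -> {subset A <= B} -> (forall a, 0 <= f a) ->
  \sum_(a <- A) f a <= \sum_(a <- B) f a.
Proof.
move=> + + f_ge0; elim: A B => [|a A IHA] B /=.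
  by move=> _ _; rewrite big_nil sumr_ge0.
case/andP=> aA uA sAB; have aB : a \in B by rewrite sAB ?mem_head.
rewrite (perm_big _ (perm_to_rem aB)) !big_cons lerD2l IHA // => b bA.
have: b \in B by rewrite sAB // inE bA orbT.
rewrite (perm_mem (perm_to_rem aB)) inE => /predU1P[ba|//].
by rewrite -ba bA in aA.
Qed.

Lemma sum_flatten_map (R : nmodType) (I T : Type) (f : I -> seq T) (s : seq I)
    (h : T -> R) :
  \sum_(y <- flatten (map f s)) h y = \sum_(i <- s) \sum_(y <- f i) h y.
Proof. by rewrite big_flatten big_map. Qed.

Lemma sum_const_seq (R : pzSemiRingType) (T : Type) (s : seq T) (c : R) :
  \sum_(i <- s) c = (size s)%:R * c.
Proof. by rewrite big_const_seq count_predT iter_addr addr0 mulr_natl. Qed.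

Lemma sum_cat_weight (R : comPzSemiRingType) (T : Type) (A B : seq (seq T)) (x : R) :
  \sum_(s <- [seq q ++ t | q <- A, t <- B]) x ^+ size s =
  (\sum_(q <- A) x ^+ size q) * \sum_(t <- B) x ^+ size t.
Proof.
rewrite big_allpairs_dep big_distrl; apply: eq_bigr => q _; rewrite big_distrr.
by apply: eq_bigr => t _; rewrite size_cat exprD.
Qed.

End WeightedLists.

(** * Port-to-port paths of a gadget *)

Definition short_seqs (F : finType) : seq (seq F) :=
  flatten [seq [seq val t | t : n.-tuple F] | n <- iota 0 #|F|.+1].

Definition gadget_paths (F : finType) (e : rel F) (p : 'I_3 -> F) (i j : 'I_3) :
    seq (seq F) :=
  [seq q <- short_seqs F | gadget_path e p i j q].

Lemma mem_short_seqs (F : finType) (q : seq F) : (q \in short_seqs F) = (size q <= #|F|)%N.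
Proof.
apply/flatten_mapP/idP => [[n]|qF].
  by rewrite mem_iota add0n ltnS => nF /mapP[t _ ->]; rewrite size_tuple.
by exists (size q); rewrite ?mem_iota //; apply/mapP; exists (in_tuple q); rewrite ?mem_enum.
Qed.

Lemma uniq_short_seqs (F : finType) : uniq (short_seqs F).
Proof.
apply: (uniq_flatten_map (k := size)) => [|n _|n _ y /mapP[t _ ->]].
- exact: iota_uniq.
- by rewrite map_inj_uniq ?enum_uniq //; apply: val_inj.
- by rewrite size_tuple.
Qed.

Lemma mem_uniq_short_seqs (F : finType) (q : seq F) : uniq q -> q \in short_seqs F.
Proof.
by move=> uq; rewrite mem_short_seqs cardE uniq_leq_size // => y _; rewrite mem_enum.
Qed.

Lemma uniq_gadget_path (F : finType) (e : rel F) (p : 'I_3 -> F) i j q :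
  gadget_path e p i j q -> uniq q.
Proof. by case: q => //= a q /and4P[]. Qed.

Lemma mem_gadget_paths (F : finType) (e : rel F) (p : 'I_3 -> F) i j q :
  (q \in gadget_paths e p i j) = gadget_path e p i j q.
Proof.
rewrite mem_filter andb_idr // => q_path.
exact: mem_uniq_short_seqs (uniq_gadget_path q_path).
Qed.

Lemma uniq_gadget_paths (F : finType) (e : rel F) (p : 'I_3 -> F) i j :
  uniq (gadget_paths e p i j).
Proof. exact: filter_uniq (uniq_short_seqs F). Qed.

(** The image of [h] is closed under adjacency, so a path that starts at a port in it stays in it
    and pulls back along [h]. This serves both for the inclusion of a gadget into the disjoint sum
    and for gadget automorphisms. *)
Lemma gadget_paths_embed (F F' : finType) (e : rel F) (e' : rel F') (h : F -> F')
    (p : 'I_3 -> F) (p' : 'I_3 -> F') (i j i' j' : 'I_3) :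
  injective h -> (forall a b, e' (h a) (h b) = e a b) ->
  (forall a b, e' (h a) b -> exists c, b = h c) ->
  p' i' = h (p i) -> p' j' = h (p j) ->
  perm_eq (gadget_paths e' p' i' j') [seq map h q | q <- gadget_paths e p i j].
Proof.
move=> h_inj h_adj h_closed pi pj; apply: uniq_perm; first exact: uniq_gadget_paths.
  by rewrite map_inj_uniq ?uniq_gadget_paths //; apply: inj_map.
have gadget_path_map q : gadget_path e' p' i' j' (map h q) = gadget_path e p i j q.
  case: q => //= a q; rewrite pi pj last_map !(inj_eq h_inj) (mem_map h_inj).
  rewrite (map_inj_uniq h_inj) path_map.
  by congr [&& _, _, _ & _]; apply: eq_path => b c /=; rewrite h_adj.
move=> q'; rewrite mem_gadget_paths; apply/idP/mapP => [q'_path | [q q_path ->]]; last first.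
  by rewrite gadget_path_map -mem_gadget_paths.
suff [q q'E] : exists q, q' = map h q.
  by exists q => //; rewrite mem_gadget_paths -gadget_path_map -q'E.
case: q' q'_path => //= _ q' /and4P[/eqP-> _ q'_path _]; rewrite pi in q'_path *.
elim: q' (p i) q'_path => [|b q' IHq'] a /=; first by exists [:: a].
case/andP=> ab; have [c bE] := h_closed _ _ ab.
by rewrite bE => /IHq'[q qE]; exists (a :: q); rewrite qE.
Qed.

Lemma gadget_paths_rev (F : finType) (e : rel F) (p : 'I_3 -> F) i j : symmetric e ->
  perm_eq (gadget_paths e p i j) (map rev (gadget_paths e p j i)).
Proof.
move=> e_sym; apply: uniq_perm; first exact: uniq_gadget_paths.
  by rewrite map_inj_uniq ?uniq_gadget_paths //; apply: (can_inj revK).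
have rev_gadget_path k l q : gadget_path e p k l q -> gadget_path e p l k (rev q).
  case: q => // a q /and4P[/eqP ak /eqP lq q_path q_uniq].
  have rev_last : last (last a q) (rev (belast a q)) = a.
    by case: (q) => //= b q'; rewrite rev_cons last_rcons.
  have revE : rev (a :: q) = last a q :: rev (belast a q) by rewrite lastI rev_rcons.
  rewrite revE; apply/and4P; split.
  - by rewrite lq.
  - by rewrite rev_last ak.
  - by rewrite rev_path -(eq_path (e := e)) // => b c; apply: e_sym.
  - by rewrite -revE rev_uniq.
move=> q; rewrite mem_gadget_paths; apply/idP/mapP => [q_path | [q' + ->]].
  by exists (rev q); rewrite ?revK ?mem_gadget_paths ?rev_gadget_path.
by rewrite mem_gadget_paths; apply: rev_gadget_path.
Qed.

(** The starting vertex [v] is left out of the lists, so [n] is both the number of steps and the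
    length of the list. *)
Definition saw_tails (T : eqType) (r : rel T) (v : T) (n : nat)
    (L : seq (seq T)) : Prop :=
  uniq L /\ forall s, (s \in L) = [&& size s == n, path r v s & uniq (v :: s)].

(** * Lifting walks to the substituted graph and projecting them back *)

Section Substitution.
Local Open Scope ring_scope.
Variables (V : eqType) (adj : rel V) (col : V -> bool) (lab : V -> V -> 'I_3).
Variables (F : finType) (e : rel F) (P : bool -> 'I_3 -> F).
Variables (R : numDomainType) (x : R) (g : bool -> R).

Hypothesis adj_sym : symmetric adj.
Hypothesis adj_col : forall u v, adj u v -> col v = ~~ col u.
Hypothesis lab_inj : forall v u w, adj v u -> adj v w -> lab v u = lab v w -> u = w.

(** One type [F] of gadget vertices serves both colours; it will be the disjoint sum of the two
    gadgets. Pairs whose summand has the wrong colour then occur, but cannot be reached from valid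
    ones. *)
Definition radj (a b : V * F) : bool :=
  (a.1 == b.1) && e a.2 b.2 ||
  [&& adj a.1 b.1, a.2 == P (col a.1) (lab a.1 b.1)
    & b.2 == P (col b.1) (lab b.1 a.1)].

Hypothesis x_ge0 : 0 <= x.
Hypothesis sum_transits : forall c i j, i != j ->
  \sum_(q <- gadget_paths e (P c) i j) x ^+ size q = g c.

Lemma adj_irrefl v : adj v v = false.
Proof. by apply/negP => /adj_col; case: (col v). Qed.

Lemma lab_neq v u w : adj v u -> adj v w -> u != w -> lab v u != lab v w.
Proof. by move=> vu vw; apply: contra_neq; apply: lab_inj. Qed.

Definition block (v : V) (q : seq F) : seq (V * F) := [seq (v, a) | a <- q].

Lemma path_block v a q : path radj (v, a) (block v q) = path e a q.
Proof. by elim: q a => //= b q IHq a; rewrite IHq /radj /= eqxx adj_irrefl orbF. Qed.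

Lemma last_block v a q : last (v, a) (block v q) = (v, last a q).
Proof. by rewrite (last_map (fun b => (v, b))). Qed.

Lemma uniq_block v (q : seq F) : uniq (block v q) = uniq q.
Proof. by apply: map_inj_uniq => a b []. Qed.

Lemma uniq_block_cat v (q : seq F) (t : seq (V * F)) :
  uniq q -> uniq t -> v \notin map fst t -> uniq (block v q ++ t).
Proof.
move=> q_uniq t_uniq v_t; rewrite cat_uniq uniq_block q_uniq t_uniq andbT /=.
apply/hasPn => -[z b] zb_t; apply: contra v_t => /mapP[b' _ [zv _]].
by rewrite -zv; apply/mapP; exists (z, b).
Qed.

(** Weight of crossing [m] successive gadgets, the first of which sits at a neighbour of a vertex of
    colour [c]; hence the initial negation. *)
Fixpoint alt_weight (c : bool) (m : nat) : R :=
  if m is m'.+1 then g (~~ c) * alt_weight (~~ c) m' else 1.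

(** The vertex [u] precedes [v] and only determines the entry port. Every gadget of [v :: s] is
    crossed except the last, where the lift stops at the entry port. *)
Fixpoint lifts (u v : V) (s : seq V) : seq (seq (V * F)) :=
  if s is w :: s' then
    [seq q ++ t | q <- [seq block v q | q <- gadget_paths e (P (col v)) (lab v u) (lab v w)],
                  t <- lifts v w s']
  else [:: [:: (v, P (col v) (lab v u))]].

Lemma sum_block v (A : seq (seq F)) :
  \sum_(q <- [seq block v q | q <- A]) x ^+ size q = \sum_(q <- A) x ^+ size q.
Proof. by rewrite big_map; apply: eq_bigr => q _; rewrite size_map. Qed.

(** Weights multiply under concatenation. Since the base walk is self-avoiding, the entry and exit
    ports of each gadget differ and its crossings sum to [g]; the final factor [x] is the entry port
    of the last gadget. *)
Lemma sum_lifts u v s : adj u v -> path adj v s -> uniq (u :: v :: s) ->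
  \sum_(t <- lifts u v s) x ^+ size t = alt_weight (col u) (size s) * x.
Proof.
elim: s u v => [|w s IHs] u v uv; first by rewrite /= big_seq1 mul1r.
rewrite /= => /andP[vw vs] /andP[u_s us].
rewrite sum_cat_weight sum_block IHs // sum_transits; last first.
  by apply: lab_neq; rewrite // 1?adj_sym //; apply: contraNneq u_s => ->; rewrite !inE eqxx orbT.
by rewrite (adj_col uv) mulrA.
Qed.

(* The first coordinates of a lift are constant on blocks, so [undup] recovers the walk. *)
Lemma liftsP u v s t : adj u v -> path adj v s -> uniq (v :: s) -> t \in lifts u v s ->
  [/\ exists t', t = (v, P (col v) (lab v u)) :: t',
      undup (map fst t) = v :: s,
      uniq t &
      path radj (u, P (col u) (lab u v)) t].
Proof.
elim: s u v t => [|w s IHs] u v t uv.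
  move=> _ _; rewrite inE => /eqP->; split=> //; first by exists [::].
  by rewrite /= /radj /= uv !eqxx orbT.
move=> /= /andP[vw ws] /andP[v_s ws_uniq] /allpairsP[[q1 t1] /= [/mapP[q q_tr ->] t1_l ->]].
move: q_tr; rewrite mem_gadget_paths => q_tr.
have [[t' t1E] t1_fst t1_uniq t1_path] := IHs v w t1 vw ws ws_uniq t1_l.
have v_t1 : v \notin map fst t1 by rewrite -mem_undup t1_fst.
have q_uniq := uniq_gadget_path q_tr.
case: q q_tr q_uniq => //= a q /and4P[/eqP-> /eqP lq eq _] q_uniq.
split.
- by eexists.
- rewrite map_cat -map_comp; have -> : map (fst \o pair v) q = nseq (size q) v.
    by elim: (q) => //= b q' ->.
  elim: (size q) => /= [|k IHk]; first by rewrite (negbTE v_t1) t1_fst.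
  by rewrite mem_head.
- exact: (uniq_block_cat (q := _ :: q)).
- rewrite /= cat_path path_block eq last_block lq t1_path !andbT.
  by rewrite /radj /= uv !eqxx orbT.
Qed.

Lemma uniq_lifts u v s : adj u v -> path adj v s -> uniq (v :: s) -> uniq (lifts u v s).
Proof.
elim: s u v => //= w s IHs u v uv /andP[vw ws] /andP[v_ws ws_uniq].
apply: allpairs_uniq; rewrite ?IHs //.
  rewrite map_inj_uniq ?uniq_gadget_paths //.
  by apply: inj_map => a b [].
(* The block of [v] ends at the first vertex off the gadget of [v], so a concatenation determines
   its two factors. *)
have findE q t : t \in lifts v w s -> find (fun a => a.1 != v) (block v q ++ t) = size q.
  move=> t_l; have [[t' ->] _ _ _] := liftsP vw ws ws_uniq t_l.
  elim: q => /= [|b q ->]; last by rewrite eqxx.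
  suff -> : w != v by [].
  by apply: contraTneq vw => ->; rewrite adj_irrefl.
move=> a1 a2 /allpairsP[[q1 t1] /= [/mapP[q _ ->] t1_l ->]].
move=> /allpairsP[[q2 t2] /= [/mapP[q' _ ->] t2_l ->]] /= eq_cat.
have := congr1 (find (fun a => a.1 != v)) eq_cat.
rewrite !findE // => size_eq; move/eqP: eq_cat.
by rewrite eqseq_cat ?size_map // => /andP[/eqP-> /eqP->].
Qed.

(** The lifts of a walk with [m.+1] steps start at the port through which it leaves [v0] and cross
    [m] gadgets; [x ^+ 2] pays for the starting port and the final entry port. Distinct walks have
    disjoint sets of lifts, all found among the self-avoiding walks from the three ports at [v0]. *)
Lemma saw_lower_bound (v0 : V) (m : nat) (L : seq (seq V))
    (Lt : 'I_3 -> nat -> seq (seq (V * F))) :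
  saw_tails adj v0 m.+1 L ->
  (forall i n, saw_tails radj (v0, P (col v0) i) n (Lt i n)) ->
  exists N, (size L)%:R * (alt_weight (col v0) m * x ^+ 2) <=
    \sum_(i < 3) \sum_(0 <= n < N) (size (Lt i n))%:R * x ^+ n.+1.
Proof.
move=> [L_uniq memL] Lt_saws.
pose start s := (v0, P (col v0) (lab v0 (head v0 s))).
pose full s := [seq start s :: t | t <- lifts v0 (head v0 s) (behead s)].
pose A := flatten (map full L).
pose Lfull i n := [seq (v0, P (col v0) i) :: t | t <- Lt i n].
(* A lift has one step fewer than it has vertices, hence fewer than [N] steps. *)
pose N := (\max_(a <- A) size a)%N; exists N.
have L_cons s : s \in L ->
    [/\ s = head v0 s :: behead s, adj v0 (head v0 s),
        path adj (head v0 s) (behead s), uniq (v0 :: head v0 s :: behead s)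
      & size (behead s) = m].
  by rewrite memL; case: s => //= w s /and5P[/eqP[->] /andP[vw ->] -> -> ->].
have A_uniq : uniq A.
  (* Projecting a lift without its start and removing duplicates gives back the tail of the base
     walk. *)
  apply: (uniq_flatten_map (k := fun t => undup (map fst (behead t)))) => // s sL.
    have [sE vw ws us _] := L_cons _ sL.
    rewrite map_inj_uniq ?uniq_lifts //; first by case/andP: us.
    by move=> a b [].
  move=> _ /mapP[t t_l ->] /=; have [sE vw ws us _] := L_cons _ sL.
  by case/andP: us => _ us; have [_ -> _ _] := liftsP vw ws us t_l.
have -> : (size L)%:R * (alt_weight (col v0) m * x ^+ 2) = \sum_(a <- A) x ^+ size a.
  rewrite sum_flatten_map big_seq (eq_bigr (fun=> alt_weight (col v0) m * x ^+ 2)).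
    by rewrite -big_seq sum_const_seq.
  move=> s sL; have [sE vw ws us <-] := L_cons _ sL.
  rewrite big_map /= (eq_bigr (fun t => x * x ^+ size t)) => [|t _]; last exact: exprS.
  by rewrite -big_distrr /= (sum_lifts vw ws us) mulrCA expr2.
apply: (@le_trans _ _ (\sum_(a <- flatten [seq flatten [seq Lfull i n | n <- iota 0 N] |
   i <- enum 'I_3]) x ^+ size a)).
  apply: ler_sum_subset => // [a aA|a]; last exact: exprn_ge0.
  case/flatten_mapP: (aA) => s sL /mapP[t t_l aE].
  have [sE vw ws us _] := L_cons _ sL.
  case/andP: us => v0_s us.
  have [[t' _] t_fst t_uniq t_path] := liftsP vw ws us t_l.
  apply/flatten_mapP; exists (lab v0 (head v0 s)); first by rewrite mem_enum.
  apply/flatten_mapP; exists (size t).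
    rewrite mem_iota add0n /= /N (big_rem a) //= leq_max.
    by rewrite {1}aE /= ltnSn.
  apply/mapP; exists t => //; have [_ ->] := Lt_saws (lab v0 (head v0 s)) (size t).
  rewrite eqxx t_path /= t_uniq andbT; apply/negP => v0_t.
  move/negP: v0_s; apply; rewrite -t_fst mem_undup.
  by apply/mapP; exists (v0, P (col v0) (lab v0 (head v0 s))).
rewrite sum_flatten_map big_enum /=; apply: ler_sum => i _.
rewrite sum_flatten_map /index_iota subn0.
apply: ler_sum => n _; rewrite big_map big_seq (eq_bigr (fun=> x ^+ n.+1)).
  by rewrite -big_seq sum_const_seq.
by move=> t; have [_ ->] := Lt_saws i n; case/andP=> /eqP /= ->.
Qed.


Variable nbr : V -> seq V.
Hypothesis mem_nbr : forall v w, (w \in nbr v) = adj v w.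
Hypothesis size_nbr : forall v, size (nbr v) = 3%N.

(** The pieces need not be paths and may be empty: they only serve for an upper bound. *)
Definition exits (v : V) : seq (seq (V * F)) :=
  flatten [seq [seq block w q | q <- short_seqs F] | w <- nbr v].

(* Transits of all vertices of [v :: s] but the last, then an arbitrary piece of the last gadget
   followed by an arbitrary piece of an adjacent one. *)
Fixpoint long_lifts (u v : V) (s : seq V) : seq (seq (V * F)) :=
  if s is w :: s' then
    [seq q ++ t | q <- [seq block v q | q <- gadget_paths e (P (col v)) (lab v u) (lab v w)],
                  t <- long_lifts v w s']
  else [seq q ++ t | q <- [seq block v q | q <- short_seqs F], t <- exits v].

Definition short_sum : R := \sum_(q <- short_seqs F) x ^+ size q.

Lemma short_sum_ge0 : 0 <= short_sum.
Proof. by apply: sumr_ge0 => q _; apply: exprn_ge0. Qed.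

Lemma alt_weight_ge0 c m : 0 <= alt_weight c m.
Proof.
elim: m c => [|m IHm] c /=; first exact: ler01.
rewrite mulr_ge0 // -(@sum_transits _ ord0 ord_max) //.
by apply: sumr_ge0 => q _; apply: exprn_ge0.
Qed.

Lemma sum_exits v : \sum_(t <- exits v) x ^+ size t = 3%:R * short_sum.
Proof.
rewrite sum_flatten_map (eq_bigr (fun=> short_sum)) => [|w _]; last exact: sum_block.
by rewrite sum_const_seq size_nbr.
Qed.

(** The walk [v :: s] may come back to [u] later, since the gadget where a walk starts can be
    entered again; only an immediate return is excluded, which makes the first entry and exit ports
    differ. For empty [s] the default of [head] turns the condition into [u != v]. *)
Lemma sum_long_lifts u v s : adj u v -> path adj v s -> uniq (v :: s) -> u != head v s ->
  \sum_(t <- long_lifts u v s) x ^+ size t =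
  alt_weight (col u) (size s) * (short_sum * (3%:R * short_sum)).
Proof.
elim: s u v => [|w s IHs] u v uv.
  by move=> _ _ _; rewrite /= sum_cat_weight sum_block sum_exits mul1r.
rewrite /= => /andP[vw ws] /andP[v_ws us] uw.
rewrite sum_cat_weight sum_block IHs // ?sum_transits; first by rewrite (adj_col uv) -mulrA.
  by apply: lab_neq; rewrite // adj_sym.
by case: (s) v_ws => [|z s'] /=; rewrite !inE ?negb_or // => /and3P[].
Qed.

(** Cuts the walk at its first departure from the gadget of [v]. A step of [radj] out of a gadget
    follows a base edge and joins the two ports attached to it, which fixes the vertices on both
    sides of the cut. *)
Lemma peel_block v a r : path radj (v, a) r ->
  exists q t, [/\ r = block v q ++ t, path e a q &
    t = [::] \/ exists w t', [/\ t = (w, P (col w) (lab w v)) :: t', adj v w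
      & last a q = P (col v) (lab v w)]].
Proof.
elim: r a => [|[w b] r IHr] a /=; first by exists [::], [::]; split => //; left.
case/andP=> /orP[/andP[/eqP/= <- ab]|/and3P[/= vw /eqP aE /eqP bE]] r_path.
  by have [q [t [-> q_path tP]]] := IHr _ r_path; exists (b :: q), t; rewrite /= ab.
by exists [::], ((w, b) :: r); split=> //; right; exists w, r; rewrite -bE.
Qed.

Lemma mem_long_lifts_nil u v q t :
  uniq q -> t \in exits v -> block v q ++ t \in long_lifts u v [::].
Proof.
move=> q_uniq t_exit; apply/allpairsP; exists (block v q, t); split=> //.
by apply: map_f; apply: mem_uniq_short_seqs.
Qed.

Lemma mem_exits v w q : adj v w -> uniq q -> block w q \in exits v.
Proof.
move=> vw q_uniq; apply/flatten_mapP; exists w; first by rewrite mem_nbr.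
by apply: map_f; apply: mem_uniq_short_seqs.
Qed.

Definition two_ports (z : V) (t : seq (V * F)) : Prop :=
  exists i j, [/\ i != j, (z, P (col z) i) \in t & (z, P (col z) j) \in t].

(* A gadget has only three ports. *)
Lemma two_ports_disjoint z t1 t2 :
  uniq (t1 ++ t2) -> two_ports z t1 -> two_ports z t2 -> False.
Proof.
move=> t_uniq [i [j [ij i1 j1]]] [k [l [kl k2 l2]]].
have disj m n : (z, P (col z) m) \in t1 -> (z, P (col z) n) \in t2 -> m != n.
  move=> m1 n2; apply: contraTneq t_uniq => mn.
  rewrite cat_uniq; apply/negP => /and3P[_ /hasPn /(_ _ n2) /negP[]].
  by rewrite -mn.
have := card_uniqP (s := [:: i; j; k; l]).
have := max_card (mem [:: i; j; k; l]); rewrite card_ord => le3 card4.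
suff /card4 cE : uniq [:: i; j; k; l] by rewrite cE in le3.
by rewrite /= !inE !negb_or ij kl !disj.
Qed.

(* Each gadget crossed uses two of its three ports, so it is crossed only once: the vertices
   crossed form a self-avoiding walk. *)
Lemma long_lifts_cover (u v : V) (r : seq (V * F)) (l := (v, P (col v) (lab v u)) :: r) :
  adj u v -> (exists w, adj v w) ->
  path radj (v, P (col v) (lab v u)) r -> uniq ((u, P (col u) (lab u v)) :: l) ->
  exists s, [/\ path adj v s && uniq (v :: s), l \in long_lifts u v s, (size s <= size r)%N,
    u != head v s & (exists q, l = block v q) \/ {in v :: s, forall z, two_ports z l}].
Proof.
rewrite {}/l; have [n] := ubnP (size r).
elim: n => // n IHn in u v r *; rewrite ltnS => rn uv [v1 vv1] r_path l_uniq.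
have [q [t [rE q_path tP]]] := peel_block r_path.
set a := P (col v) (lab v u) in r_path l_uniq q_path tP *.
have lE : (v, a) :: r = block v (a :: q) ++ t by rewrite rE.
have [l_u l_uniq'] := andP l_uniq; rewrite -/(uniq (_ :: _)) in l_uniq'.
have aq_uniq : uniq (a :: q).
  by rewrite -(uniq_block v); move: l_uniq'; rewrite lE cat_uniq => /and3P[].
case: tP => [t0 | [w [t' [tE vw last_q]]]].
  (* The walk ends in the gadget of [v]; its exit piece is empty and is attributed to the neighbour
     [v1]. *)
  exists [::]; split=> //; last by left; exists (a :: q); rewrite lE t0 cats0.
    2: by apply: contraTneq uv => /= ->; rewrite adj_irrefl.
  rewrite lE; apply: mem_long_lifts_nil => //.
  by rewrite t0 -[[::]]/(block v1 [::]); apply: mem_exits.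
(* An immediate return to [u] would pass again through the port from which [v] was entered. *)
have uw : u != w.
  apply: contraNneq l_u => uw; rewrite lE tE -uw !(inE, mem_cat) eqxx.
  by rewrite !orbT.
have lab_uw : lab v u != lab v w by apply: lab_neq => //; rewrite adj_sym.
have v_ports : two_ports v (block v (a :: q)).
  exists (lab v u), (lab v w); split=> //; first exact: mem_head.
  by rewrite -last_q -last_block; apply: mem_last.
have block_sub : {subset block v (a :: q) <= (v, a) :: r}.
  by move=> z; rewrite lE mem_cat => ->.
have t_sub : {subset t <= (v, a) :: r} by move=> z; rewrite lE mem_cat orbC => ->.
have ports_sub z t1 : {subset t1 <= (v, a) :: r} -> two_ports z t1 -> two_ports z ((v, a) :: r).
  by move=> t1_sub [i [j [ij i1 j1]]]; exists i, j; split=> //; apply: t1_sub.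
have t_path : path radj (w, P (col w) (lab w v)) t'.
  by move: r_path; rewrite rE tE cat_path /= => /and3P[].
have t_uniq : uniq ((v, P (col v) (lab v w)) :: (w, P (col w) (lab w v)) :: t').
  move: l_uniq'; rewrite lE tE cat_uniq -last_q -last_block => /and3P[_ dis tt_uniq].
  rewrite cons_uniq tt_uniq andbT; apply: contra dis => v_t; apply/hasP; exists (last (v, a) (block v q)) => //.
  exact: mem_last.
have t_small : (size t' < n)%N.
  by apply: leq_trans rn; rewrite rE tE size_cat /= addnS ltnS leq_addl.
have wv : adj w v by rewrite adj_sym.
have [s [/andP[ws ws_uniq] s_lift s_size _ s_ports]] :=
  IHn _ _ _ t_small vw (ex_intro _ v wv) t_path t_uniq.
rewrite -tE in s_lift s_ports.
(* If the rest stays in the gadget of [w], it becomes the exit piece. That last gadget may have been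
   crossed earlier through its two other ports, so [w] must stay out of the walk. *)
case: s_ports => [[q' t_block] | s_ports].
  exists [::]; split=> //; last first.
  - by right=> z; rewrite inE => /eqP->; apply: ports_sub v_ports.
  - by apply: contraTneq uv => /= ->; rewrite adj_irrefl.
  rewrite lE t_block; apply: mem_long_lifts_nil => //; apply: mem_exits => //.
  by rewrite -(uniq_block w) -t_block tE; case/andP: t_uniq.
exists (w :: s); split.
(* A repetition of [v] would give two ports of its gadget in the block and two others in [t]. *)
- rewrite cons_uniq ws_uniq andbT /= vw ws /=; apply/negP => /s_ports.
  by apply: two_ports_disjoint v_ports; rewrite -lE.
- apply/allpairsP; exists (block v (a :: q), t); split=> //; apply: map_f.
  rewrite mem_gadget_paths.
  by rewrite /gadget_path eqxx last_q eqxx q_path aq_uniq.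
- by rewrite rE tE size_cat /= addnS ltnS (leq_trans s_size) ?leq_addl.
- exact: uw.
right=> z; rewrite inE => /predU1P[->|/s_ports]; first exact: ports_sub v_ports.
exact: ports_sub.
Qed.

(** The first [short_sum] pays for the piece inside the gadget of [v0], the other two and the factor
    3 for the last piece and the exit. In between, the walk crosses the gadgets along a
    self-avoiding walk from a neighbour of [v0]; overcounting is harmless. *)
Lemma saw_upper_bound (v0 : V) (a0 : F) (n : nat) (Lt : seq (seq (V * F)))
    (L : V -> nat -> seq (seq V)) :
  saw_tails radj (v0, a0) n Lt ->
  (forall v k, saw_tails adj v k (L v k)) ->
  (size Lt)%:R * x ^+ n.+1 <=
    short_sum * (short_sum * (3%:R * short_sum)) *
    \sum_(v <- nbr v0) \sum_(0 <= k < n.+1) (size (L v k))%:R * alt_weight (col v0) k.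
Proof.
move=> [Lt_uniq memLt] L_saws.
have [v1 vv1] : exists w, adj v0 w.
  by case: (nbr v0) (size_nbr v0) (mem_nbr v0) => // w s _ wP; exists w; rewrite -wP mem_head.
pose good v k := [seq s <- L v k | v0 != head v s].
pose B := [seq q ++ t | q <- [seq block v0 q | q <- short_seqs F],
  t <- flatten [seq flatten [seq flatten [seq long_lifts v0 v s | s <- good v k]
    | k <- iota 0 n.+1] | v <- nbr v0]].
have memB q v s t : uniq q -> v \in nbr v0 -> path adj v s -> uniq (v :: s) ->
    (size s <= n)%N -> v0 != head v s -> t \in long_lifts v0 v s -> block v0 q ++ t \in B.
  move=> q_uniq v_nbr s_path s_uniq s_size s_head t_s.
  apply: allpairs_f.
    by apply: map_f; apply: mem_uniq_short_seqs.
  apply/flatten_mapP; exists v => //.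
  apply/flatten_mapP; exists (size s); first by rewrite mem_iota.
  apply/flatten_mapP; exists s => //; rewrite mem_filter s_head.
  by have [_ ->] := L_saws v (size s); rewrite eqxx s_path.
apply: (@le_trans _ _ (\sum_(t <- B) x ^+ size t)).
  have -> : (size Lt)%:R * x ^+ n.+1 = \sum_(a <- [seq (v0, a0) :: t | t <- Lt]) x ^+ size a.
    rewrite big_map big_seq (eq_bigr (fun=> x ^+ n.+1)).
      by rewrite -big_seq sum_const_seq.
    by move=> t; rewrite memLt /= => /andP[/eqP->].
  apply: ler_sum_subset => [|l|a]; last exact: exprn_ge0.
    by rewrite map_inj_uniq // => a b [].
  case/mapP=> r; rewrite memLt => /and3P[/eqP r_size r_path l_uniq] ->.
  have [q [t [rE q_path tP]]] := peel_block r_path.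
  have lE : (v0, a0) :: r = block v0 (a0 :: q) ++ t by rewrite rE.
  have aq_uniq : uniq (a0 :: q).
    by rewrite -(uniq_block v0); move: l_uniq; rewrite lE cat_uniq => /and3P[].
  rewrite lE; case: tP => [t0 | [w [t' [tE vw last_q]]]].
    (* The walk never leaves the gadget of [v0]: it is padded with empty pieces at a neighbour [v1]
       and at [v0]. *)
    have v1_v0 : v0 != head v1 [::].
      by apply: contraTneq vv1 => /= ->; rewrite adj_irrefl.
    apply: (@memB _ v1 [::]) => //; first by rewrite mem_nbr.
    by rewrite t0 -[[::]]/(block v1 [::] ++ block v0 [::]);
      apply: mem_long_lifts_nil => //; apply: mem_exits; rewrite // adj_sym.
  have t_path : path radj (w, P (col w) (lab w v0)) t'.
    by move: r_path; rewrite rE tE cat_path /= => /and3P[].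
  have t_uniq : uniq ((v0, P (col v0) (lab v0 w)) :: (w, P (col w) (lab w v0)) :: t').
    move: l_uniq; rewrite lE tE cat_uniq -last_q -last_block => /and3P[_ dis tt_uniq].
    rewrite cons_uniq tt_uniq andbT; apply: contra dis => v_t.
    by apply/hasP; exists (last (v0, a0) (block v0 q)) => //; apply: mem_last.
  have wv : adj w v0 by rewrite adj_sym.
  have [s [/andP[ws ws_uniq] s_lift s_size s_head _]] :=
    long_lifts_cover vw (ex_intro _ v0 wv) t_path t_uniq.
  rewrite -tE in s_lift; apply: memB s_lift => //; first by rewrite mem_nbr.
  by apply: leq_trans s_size _; rewrite -r_size rE tE size_cat /= addnS leqW ?leq_addl.
rewrite sum_cat_weight sum_block -/short_sum -mulrA ler_wpM2l ?short_sum_ge0 //.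
rewrite sum_flatten_map mulr_sumr big_seq [leRHS]big_seq; apply: ler_sum => v v_nbr.
rewrite sum_flatten_map mulr_sumr /index_iota subn0; apply: ler_sum => k _.
rewrite sum_flatten_map.
have -> : \sum_(s <- good v k) \sum_(t <- long_lifts v0 v s) x ^+ size t =
    (size (good v k))%:R * (alt_weight (col v0) k * (short_sum * (3%:R * short_sum))).
  rewrite big_seq (eq_bigr (fun=> alt_weight (col v0) k * (short_sum * (3%:R * short_sum)))).
    by rewrite -big_seq sum_const_seq.
  have [_ memL] := L_saws v k.
  move=> s; rewrite mem_filter memL => /and4P[s_head /eqP <- s_path s_uniq].
  by apply: sum_long_lifts; rewrite -?mem_nbr.
rewrite [leRHS]mulrC -mulrA ler_wpM2r ?mulr_ge0 ?short_sum_ge0 ?alt_weight_ge0 ?ler0n //.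
by rewrite ler_nat size_filter count_size.
Qed.

End Substitution.

(** * The gadget series and its symmetry *)

Section GadgetSeries.
Local Open Scope ring_scope.

Definition path_sum (F : finType) (e : rel F) (p : 'I_3 -> F) (i j : 'I_3)
    (R : numDomainType) (x : R) : R :=
  \sum_(q <- gadget_paths e p i j) x ^+ size q.

Lemma path_sum_embed (F F' : finType) (e : rel F) (e' : rel F') (h : F -> F')
    (p : 'I_3 -> F) (p' : 'I_3 -> F') (i j i' j' : 'I_3) (R : numDomainType) (x : R) :
  injective h -> (forall a b, e' (h a) (h b) = e a b) ->
  (forall a b, e' (h a) b -> exists c, b = h c) ->
  p' i' = h (p i) -> p' j' = h (p j) ->
  path_sum e' p' i' j' x = path_sum e p i j x.
Proof.
move=> h_inj h_adj h_closed pi pj.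
rewrite /path_sum (perm_big _ (gadget_paths_embed h_inj h_adj h_closed pi pj)) big_map.
by apply: eq_bigr => q _; rewrite size_map.
Qed.

Lemma path_sum_sym (F : finType) (e : rel F) (p : 'I_3 -> F) i j
    (R : numDomainType) (x : R) :
  symmetric e -> path_sum e p i j x = path_sum e p j i x.
Proof.
move=> e_sym; rewrite /path_sum (perm_big _ (gadget_paths_rev p i j e_sym)) big_map.
by apply: eq_bigr => q _; rewrite size_rev.
Qed.

(* Transitivity on the three ports gives transitivity on unordered pairs of ports: move the third
   port. *)
Lemma path_sum_ports (F : finType) (e : rel F) (p : 'I_3 -> F) i j
    (R : numDomainType) (x : R) :
  gadget e p -> i != j -> path_sum e p i j x = path_sum e p ord0 (inord 1) x.
Proof.
move=> [e_sym [_ [_ [p_inj [H [H_aut H_trans]]]]]] ij.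
have [k ik jk] : exists2 k, k != i & k != j.
  have /subsetPn[k _] : ~~ ([set: 'I_3] \subset [set i; j]).
    by apply/negP => /subset_leq_card; rewrite cardsT card_ord cards2 ij.
  by rewrite !inE negb_or => /andP[]; exists k.
(* With the third port sent to [ord_max], [i] and [j] go to the ports 0 and 1 in some order;
   reversing paths settles the order. *)
have [s [sH sk]] := H_trans k ord_max; have [s_adj s_ports] := H_aut s sH.
have [i' si] := s_ports i; have [j' sj] := s_ports j.
have s_inj : injective s by apply: perm_inj.
have neq a b a' b' : s (p a) = p a' -> s (p b) = p b' -> a != b -> a' != b'.
  by move=> sa sb; apply: contra_neq => ab; apply/p_inj/s_inj; rewrite sa sb ab.
have i'3 := neq _ _ _ _ si sk; have j'3 := neq _ _ _ _ sj sk; have ij' := neq _ _ _ _ si sj ij.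
rewrite eq_sym in ik; rewrite eq_sym in jk; move: (i'3 ik) (j'3 jk) ij' => {}i'3 {}j'3 {neq}.
have s_closed a b : e (s a) b -> exists c, b = s c by exists ((s^-1)%g b); rewrite permKV.
rewrite -(path_sum_embed x s_inj s_adj s_closed (esym si) (esym sj)).
have port01 (k' : 'I_3) : k' != ord_max -> k' = ord0 \/ k' = inord 1.
  by case: k' => -[|[|[|k']]] k'3 // _; [left | right]; apply: val_inj; rewrite /= ?inordK.
by case: (port01 _ i'3) (port01 _ j'3) => -> [] ->; rewrite ?eqxx // => _; apply: path_sum_sym.
Qed.

Lemma path_sum_series (F : finType) (e : rel F) (p : 'I_3 -> F) (x : R) :
  path_sum e p ord0 (inord 1) x = gadget_series e p x.
Proof.
rewrite /gadget_series sum_f_R0E /path_sum big_filter big_mkcond sum_flatten_map.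
rewrite /index_iota subn0; apply: eq_bigr => n _; rewrite big_map big_enum /= -big_mkcond /=.
rewrite (eq_bigr (fun=> x ^+ n)) => [|t _]; last by rewrite size_tuple.
rewrite sumr_const RmultE RpowE INRE mulr_natl /gadget_path_count.
by congr (_ *+ _); apply: eq_card => t; rewrite !inE.
Qed.

Lemma continuity_gadget_series (F : finType) (e : rel F) (p : 'I_3 -> F) :
  continuity (gadget_series e p).
Proof.
have continuity_term n : continuity (fun x => Rmult (INR (gadget_path_count e p n)) (pow x n)).
  by apply: continuity_mult; [apply: continuity_const | apply/derivable_continuous/derivable_pow].
rewrite /gadget_series; elim: #|F| => [|n IHn]; first exact: (continuity_term 0%N).
exact: continuity_plus IHn (continuity_term n.+1).
Qed.

End GadgetSeries.

(** * Limits of roots and comparison of critical points *)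

Section RealAnalysis.
Local Open Scope R_scope.

Lemma pow_root (s n : nat) : (0 < s)%N -> (0 < n)%N ->
  Rpower (INR s) (/ INR n) ^ n = INR s.
Proof.
move=> s_gt0 n_gt0; have s_pos : 0 < INR s by apply/lt_0_INR/ssrnat.ltP.
have n_neq0 : INR n <> 0 by apply/not_0_INR => n0; rewrite n0 in n_gt0.
rewrite -Rpower_pow; last exact: exp_pos.
by rewrite Rpower_mult Rinv_l // Rpower_1.
Qed.

Lemma root_limit_upper (s : nat -> nat) (mu c : R) :
  Un_cv (fun n => Rpower (INR (s n)) (/ INR n)) mu -> (forall n, (0 < s n)%N) -> mu < c ->
  exists N, forall n, (N <= n)%N -> INR (s n) <= c ^ n.
Proof.
move=> s_cv s_gt0 mu_c; have [N closeN] := s_cv (c - mu) (Rlt_Rminus _ _ mu_c).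
(* Starting at [N.+1] makes [n] positive, so that the power undoes the root. *)
exists N.+1 => n Nn; have /closeN : (n >= N)%coq_nat by apply/ssrnat.leP/ltnW.
move=> /Rabs_def2[near _]; rewrite -(@pow_root (s n) n) ?(leq_trans _ Nn) //.
by apply: pow_incr; split; [apply/Rlt_le/exp_pos | lra].
Qed.

Lemma root_limit_lower (s : nat -> nat) (mu c : R) :
  Un_cv (fun n => Rpower (INR (s n)) (/ INR n)) mu -> (forall n, (0 < s n)%N) -> 0 < c < mu ->
  exists N, forall n, (N <= n)%N -> c ^ n <= INR (s n).
Proof.
move=> s_cv s_gt0 [c_gt0 c_mu]; have [N closeN] := s_cv (mu - c) (Rlt_Rminus _ _ c_mu).
exists N.+1 => n Nn; have /closeN : (n >= N)%coq_nat by apply/ssrnat.leP/ltnW.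
move=> /Rabs_def2[_ near]; rewrite -(@pow_root (s n) n) ?(leq_trans _ Nn) //.
by apply: pow_incr; lra.
Qed.

(** A limit at most 0 would be below 1/2, and the positive integers [s n] would eventually be at
    most [(/ 2) ^ n]. *)
Lemma root_limit_gt0 (s : nat -> nat) (mu : R) :
  Un_cv (fun n => Rpower (INR (s n)) (/ INR n)) mu -> (forall n, (0 < s n)%N) -> 0 < mu.
Proof.
move=> s_cv s_gt0; apply: Rnot_le_lt => mu_le0.
have [|N smallN] := root_limit_upper (c := / 2) s_cv s_gt0; first lra.
move: (smallN N.+1 (leqnSn N)); have : 1 <= INR (s N.+1) by apply: (le_INR 1); apply/ssrnat.leP.
have half : 0 <= / 2 < 1 by lra.
have [_] := pow_lt_1_compat _ _ half (PeanoNat.Nat.lt_0_succ N); lra.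
Qed.

(** If the two sides differed, continuity would preserve the strict inequality near [/ mut]. A point
    slightly to the left then contradicts the first implication when [f (/ mut)] is too large, and
    one slightly to the right contradicts the second when it is too small. *)
Lemma critical_point_eq (f : R -> R) (mu mut : R) :
  continuity f -> 0 < mu -> 0 < mut -> (forall x, 0 < x -> 0 <= f x) ->
  (forall x y, 0 < x -> x * mut < 1 -> 0 < y -> y ^ 2 <= f x -> mu * y <= 1) ->
  (forall x y, 0 < x -> 0 < y -> f x <= y ^ 2 -> mu * y < 1 -> mut * x <= 1) ->
  / mu ^ 2 = f (/ mut).
Proof.
move=> f_cont mu_gt0 mut_gt0 f_ge0 lower upper.
have x0_gt0 : 0 < / mut by apply: Rinv_0_lt_compat.
have x0_mut : / mut * mut = 1 by field; lra.
have mu2_gt0 : 0 < mu ^ 2 by apply: pow_lt.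
have imu2_gt0 : 0 < / mu ^ 2 by apply: Rinv_0_lt_compat.
have imu2 : mu ^ 2 * / mu ^ 2 = 1 by field; lra.
have cont eps : 0 < eps -> exists2 d, 0 < d &
    forall x, 0 < Rabs (x - / mut) < d -> Rabs (f x - f (/ mut)) < eps.
  move=> eps_gt0; have [d [d_gt0 fd]] := f_cont (/ mut) eps eps_gt0.
  exists d => // x [x_neq xd]; apply: fd; split=> //; split=> // xE.
  by rewrite xE Rminus_diag Rabs_R0 in x_neq; lra.
case: (Rtotal_order (/ mu ^ 2) (f (/ mut))) => [lt_f | [// | gt_f]].
- have [d d_gt0 fd] := cont _ (Rlt_Rminus _ _ lt_f).
  (* The minimum with [/ mut] keeps the point [/ mut - h] positive. *)
  pose h := Rmin d (/ mut) / 2.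
  have [h_gt0 hd hx] : [/\ 0 < h, h < d & h < / mut].
    by rewrite /h; have := Rmin_l d (/ mut); have := Rmin_r d (/ mut);
      have := Rmin_glb_lt d (/ mut) 0 d_gt0 x0_gt0; split; lra.
  have f_close : / mu ^ 2 < f (/ mut - h).
    have /fd/Rabs_def2[_ near] : 0 < Rabs ((/ mut - h) - / mut) < d.
      by rewrite Rabs_left; lra.
    lra.
  have y_sq : sqrt (f (/ mut - h)) ^ 2 = f (/ mut - h) by apply: pow2_sqrt; lra.
  have y_gt0 : 0 < sqrt (f (/ mut - h)) by apply: sqrt_lt_R0; lra.
  have h_mut : 0 < h * mut by apply: Rmult_lt_0_compat.
  have mu_y : mu * sqrt (f (/ mut - h)) <= 1 by apply: (lower (/ mut - h)) => //; lra.
  have : (mu * sqrt (f (/ mut - h))) ^ 2 <= 1 ^ 2.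
    by apply: pow_incr; split=> //; apply: Rmult_le_pos; lra.
  by rewrite Rpow_mult_distr y_sq -imu2; nra.
- have [d d_gt0 fd] := cont _ (Rlt_Rminus _ _ gt_f).
  have f_close : f (/ mut + d / 2) < / mu ^ 2.
    have /fd/Rabs_def2[near _] : 0 < Rabs ((/ mut + d / 2) - / mut) < d.
      by rewrite Rabs_right; lra.
    lra.
  have f_pos : 0 <= f (/ mut + d / 2) by apply: f_ge0; lra.
  (* The value of [f] may vanish here; the midpoint gives a positive [y] with [f x <= y ^ 2] and
     still [mu * y < 1]. *)
  pose z := (f (/ mut + d / 2) + / mu ^ 2) / 2.
  have y_sq : sqrt z ^ 2 = z by apply: pow2_sqrt; rewrite /z; lra.
  have y_gt0 : 0 < sqrt z by apply: sqrt_lt_R0; rewrite /z; lra.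
  have mu_y : mu * sqrt z < 1.
    have z_mu : z < / mu ^ 2 by rewrite /z; lra.
    have sq_lt1 : (mu * sqrt z) ^ 2 < 1 by rewrite Rpow_mult_distr y_sq -imu2; nra.
    have := Rmult_lt_0_compat _ _ mu_gt0 y_gt0; nra.
  have d_mut : 0 < d * mut by apply: Rmult_lt_0_compat.
  have mut_x : mut * (/ mut + d / 2) <= 1.
    by apply: (upper _ (sqrt z)) => //; rewrite ?y_sq /z; lra.
  lra.
Qed.

End RealAnalysis.

(** * Radii of convergence and growth of the alternating weights *)

Section Growth.
Local Open Scope ring_scope.

Lemma geometric_sum_bound (K : realFieldType) (a : nat -> K) (c y : K) (N0 : nat) :
  0 <= c -> 0 <= y -> c * y < 1 -> (forall n, 0 <= a n) ->
  (forall n, (N0 <= n)%N -> a n <= c ^+ n) ->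
  exists B, forall N, \sum_(0 <= n < N) a n * y ^+ n <= B.
Proof.
move=> c_ge0 y_ge0 cy_lt1 a_ge0 a_le.
exists (\sum_(0 <= n < N0) a n * y ^+ n + (1 - c * y)^-1) => N.
have term_ge0 n : 0 <= a n * y ^+ n by rewrite mulr_ge0 ?exprn_ge0.
have cy_ge0 : 0 <= c * y by rewrite mulr_ge0.
have geo m : \sum_(0 <= n < m) (c * y) ^+ n <= (1 - c * y)^-1.
  rewrite -[leRHS]mul1r ler_pdivlMr ?subr_gt0 // mulrC big_mkord -opprB mulNr -subrX1 opprB.
  by rewrite gerBl exprn_ge0.
elim: N => [|N IHN]; first by rewrite big_nil addr_ge0 ?sumr_ge0 ?invr_ge0 ?subr_ge0 ?ltW.
case: (ltnP N N0) => [NN0 | N0N].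
  apply: (@le_trans _ _ (\sum_(0 <= n < N0) a n * y ^+ n)).
    by rewrite (big_cat_nat (n := N.+1) (p := N0)) //= lerDl sumr_ge0.
  by rewrite lerDl invr_ge0 subr_ge0 ltW.
rewrite (big_cat_nat (n := N0)) ?(leq_trans N0N) //= lerD2l.
apply: le_trans (geo N.+1); rewrite [leRHS](big_cat_nat (n := N0)) ?(leq_trans N0N) //=.
apply: ler_wpDl; first by apply: sumr_ge0 => n _; rewrite exprn_ge0.
rewrite big_nat_cond [leRHS]big_nat_cond; apply: ler_sum => n /andP[/andP[N0n _] _].
by rewrite exprMn ler_wpM2r ?exprn_ge0 ?a_le.
Qed.

Lemma bounded_powers_le1 (z B : R) (N : nat) : 0 <= z ->
  (forall n, (N <= n)%N -> z ^+ n <= B) -> z <= 1.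
Proof.
move=> z_ge0 z_le; rewrite leNgt; apply/negP => z_gt1.
have [M big_pow] := Pow_x_infinity z
  ltac:(by rewrite RabsE ger0_norm //; apply/Rlt_gt/RltP) (B + 1).
have := big_pow (maxn M N) ltac:(by apply/ssrnat.leP/leq_maxl) => /Rge_le/RleP.
rewrite RabsE RpowE ger0_norm ?exprn_ge0 // => /le_trans/(_ (z_le _ (leq_maxr _ _))).
by rewrite gerDl ler10.
Qed.

Lemma le1_of_lt (K : realFieldType) (mu y : K) : 0 < mu -> 0 < y ->
  (forall c, 0 < c -> c < mu -> c * y <= 1) -> mu * y <= 1.
Proof.
move=> mu_gt0 y_gt0 below; rewrite leNgt; apply/negP => mu_y.
have : y^-1 < mu by rewrite -[y^-1]mul1r ltr_pdivrMr.
case/midf_lt => c_gt c_lt; have c_gt0 : 0 < (y^-1 + mu) / 2.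
  by apply: lt_trans c_gt; rewrite invr_gt0.
have := below _ c_gt0 c_lt; apply/negP; rewrite -ltNge.
by rewrite -ltr_pdivrMr // mul1r.
Qed.

Lemma root_limit_sum_bound (s : nat -> nat) (mu x : R) :
  Un_cv (fun n => Rpower (INR (s n)) (Rinv (INR n))) mu -> (forall n, (0 < s n)%N) ->
  0 < x -> x * mu < 1 -> exists B, forall N, \sum_(0 <= n < N) (s n)%:R * x ^+ n <= B.
Proof.
move=> s_cv s_gt0 x_gt0 x_mu.
have mu_gt0 : 0 < mu by apply/RltP/(root_limit_gt0 s_cv s_gt0).
have : mu < x^-1 by rewrite -[x^-1]mul1r ltr_pdivlMr // mulrC.
(* With [c] strictly between [mu] and [x^-1], the terms are eventually dominated by the convergent
   geometric series of ratio [c * x]. *)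
case/midf_lt; set c := (mu + x^-1) / 2 => /RltP mu_c c_x.
have [N0 s_le] := root_limit_upper s_cv s_gt0 mu_c.
apply: (@geometric_sum_bound _ _ c x N0) => [||||n /s_le/RleP]; last by rewrite INRE RpowE.
- by rewrite (le_trans (ltW mu_gt0)) // ltW //; apply/RltP.
- exact: ltW.
- by rewrite -ltr_pdivlMr // mul1r.
- by move=> n; apply: ler0n.
Qed.

(** Bounded terms already place [z] within the closed radius: for each positive [c < mu] the powers
    of [c * z] stay bounded, so [c * z <= 1], and [c] may approach [mu]. *)
Lemma root_limit_le1 (s : nat -> nat) (mu z M B : R) :
  Un_cv (fun n => Rpower (INR (s n)) (Rinv (INR n))) mu -> (forall n, (0 < s n)%N) ->
  0 < z -> 0 < M -> (forall n, (s n.+1)%:R * (M * z ^+ n.+1) <= B) -> mu * z <= 1.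
Proof.
move=> s_cv s_gt0 z_gt0 M_gt0 s_le.
apply: le1_of_lt => // [|c c_gt0 c_mu]; first exact/RltP/(root_limit_gt0 s_cv s_gt0).
have c_between : Rlt 0 c /\ Rlt c mu by split; apply/RltP.
have [N s_ge] := root_limit_lower s_cv s_gt0 c_between.
apply: (@bounded_powers_le1 _ (B / M) N.+1) => [|[//|n] Nn]; first by rewrite mulr_ge0 ?ltW.
rewrite ler_pdivlMr //; apply: le_trans (s_le n); rewrite exprMn -mulrA [_ * M]mulrC.
rewrite ler_wpM2r ?mulr_ge0 ?exprn_ge0 ?(ltW z_gt0) ?(ltW M_gt0) //.
by have /RleP := s_ge n.+1 (ltnW Nn); rewrite INRE RpowE.
Qed.

(** Two steps multiply the weight by [g true * g false], whatever the colour, hence by at most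
    [y ^+ 2]; [D] absorbs the cases of 0 and 1 steps. *)
Lemma alt_weight_upper (K : realFieldType) (g : bool -> K) (y : K) : 0 < y ->
  (forall c, 0 <= g c) -> g true * g false <= y ^+ 2 ->
  exists2 D, 0 < D & forall c m, alt_weight g c m <= D * y ^+ m.
Proof.
move=> y_gt0 g_ge0 g_le; pose D := 1 + (g true + g false) / y.
have D_ge1 : 1 <= D by rewrite lerDl divr_ge0 ?addr_ge0 // ltW.
have D_gt0 : 0 < D by apply: lt_le_trans D_ge1.
exists D => // c m.
suff [] : alt_weight g c m <= D * y ^+ m /\ alt_weight g c m.+1 <= D * y ^+ m.+1 by [].
elim: m => [|m [IHm IHm1]] /=.
  rewrite expr0 expr1 !mulr1; split=> //; rewrite mulrDl mul1r divfK ?gt_eqF //.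
  apply: (@le_trans _ _ (g true + g false)); last by rewrite lerDr ltW.
  by case: (c); rewrite /= ?lerDl ?lerDr g_ge0.
split=> //; rewrite negbK mulrA; apply: (@le_trans _ _ (y ^+ 2 * (D * y ^+ m))).
  have ab_ge0 : 0 <= g (~~ c) * g c by rewrite mulr_ge0.
  apply: (@le_trans _ _ (g (~~ c) * g c * (D * y ^+ m))); first exact: ler_wpM2l.
  rewrite ler_wpM2r ?mulr_ge0 ?exprn_ge0 ?(ltW D_gt0) ?(ltW y_gt0) //.
  by case: (c) => //=; rewrite mulrC.
by rewrite mulrCA -exprD.
Qed.

(** The same two-step induction from below. Positivity of the product forces both values of [g] to
    be positive, so the minimum [D] is positive. *)
Lemma alt_weight_lower (K : realFieldType) (g : bool -> K) (y : K) : 0 < y ->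
  (forall c, 0 <= g c) -> y ^+ 2 <= g true * g false ->
  exists2 D, 0 < D & forall c m, D * y ^+ m <= alt_weight g c m.
Proof.
move=> y_gt0 g_ge0 g_le.
have ab_gt0 : 0 < g true * g false by apply: lt_le_trans g_le; rewrite exprn_gt0.
have g_gt0 c : 0 < g c.
  rewrite lt_def g_ge0 andbT; apply: contraTneq ab_gt0 => gc0.
  by case: c gc0 => ->; rewrite ?mul0r ?mulr0 ltxx.
pose D := Num.min 1 (Num.min (g true / y) (g false / y)).
have D_gt0 : 0 < D by rewrite !lt_min ltr01 !divr_gt0.
exists D => // c m.
suff [] : D * y ^+ m <= alt_weight g c m /\ D * y ^+ m.+1 <= alt_weight g c m.+1 by [].
elim: m => [|m [IHm IHm1]] /=.
  rewrite expr0 expr1 !mulr1 -ler_pdivlMr // /D !ge_min lexx; split=> //.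
  by case: (c) => /=; rewrite lexx !orbT.
split=> //; rewrite negbK mulrA; apply: (@le_trans _ _ (y ^+ 2 * (D * y ^+ m))).
  by rewrite [leRHS]mulrCA -exprD.
apply: ler_pM => //; rewrite ?exprn_ge0 ?mulr_ge0 ?exprn_ge0 ?(ltW y_gt0) ?(ltW D_gt0) //.
by case: (c) => //=; rewrite mulrC.
Qed.

End Growth.

(** * Walks as paths over types with decidable equality *)

Lemma InP (T : eqType) (x : T) (s : seq T) : reflect (List.In x s) (x \in s).
Proof.
elim: s => [|y s IHs] /=; first by rewrite in_nil; constructor.
rewrite inE; apply: (iffP orP) => -[]; try by move=> /IHs; right.
- by move/eqP->; left.
- by move->; left.
Qed.

Lemma NoDupP (T : eqType) (s : seq T) : reflect (List.NoDup s) (uniq s).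
Proof.
elim: s => [|x s IHs] /=; first by do 2!constructor.
apply: (iffP andP) => [[/InP xs /IHs us]|us]; first by constructor.
by inversion us; split; [apply/InP | apply/IHs].
Qed.

Section WalksAsPaths.
Variables (T : eqType) (adj : T -> T -> Prop) (r : rel T).
Hypothesis adjP : forall u v, reflect (adj u v) (r u v).

Lemma adj_chainP (v : T) (s : seq T) : reflect (adj_chain adj (v :: s)) (path r v s).
Proof.
elim: s v => [|w s IHs] v; first by constructor.
by apply: (iffP andP) => -[/adjP vw /IHs ws]; split.
Qed.

Lemma sawP (n : nat) (v : T) (s : seq T) :
  reflect (saw adj n v (v :: s)) [&& size s == n, path r v s & uniq (v :: s)].
Proof.
apply: (iffP and3P) => [[/eqP <- /adj_chainP ? /NoDupP ?] | [[<-] [_ [? ?]]]]; first by split.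
by split; [|apply/adj_chainP|apply/NoDupP].
Qed.

Lemma saw_count_tails (n : nat) (v : T) (k : nat) : saw_count adj n v k ->
  exists2 L, saw_tails r v n L & size L = k.
Proof.
move=> [L [L_uniq [memL sizeL]]]; exists (map behead L); last by rewrite size_map.
have L_cons l : l \in L -> l = v :: behead l.
  by move/InP/memL => [_ []]; case: l => //= w s [->].
split.
  rewrite map_inj_in_uniq; first exact/NoDupP.
  by move=> l l' /L_cons lE /L_cons l'E ll'; rewrite lE l'E ll'.
move=> s; apply/mapP/sawP => [[l lL ->]|s_saw].
  by rewrite -L_cons //; apply/memL/InP.
by exists (v :: s) => //; apply/InP/memL.
Qed.

Lemma connective_constant_tails (mu : R) : connective_constant adj mu ->
  forall v, exists L : nat -> seq (seq T), (forall n, saw_tails r v n (L n)) /\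
    Un_cv (fun n => Rpower (INR (size (L n))) (Rinv (INR n))) mu.
Proof.
move=> mu_conn v; have [s [s_count s_cv]] := mu_conn v.
have /choice[L memL] n : exists L, saw_tails r v n L /\ size L = s n.
  by have [L] := saw_count_tails (s_count n); exists L.
exists L; split=> [n|]; first by case: (memL n).
suff -> : (fun n => Rpower (INR (size (L n))) (Rinv (INR n))) =
          (fun n => Rpower (INR (s n)) (Rinv (INR n))) by [].
by apply/funext => n; case: (memL n) => _ ->.
Qed.

Lemma connected_path : connected_graph adj ->
  forall u v, exists2 s, path r u s & last u s = v.
Proof.
move=> conn u v; have [[|w s] [//= [wu] [last_s [_ s_chain]]]] := conn u v => //.
exists s; first by apply/adj_chainP; rewrite -wu.
by rewrite -last_s -{1}wu; elim: (s) (w) => [|x s' IHs] y //=.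
Qed.

(** Any vertex is reached from [v] by a self-avoiding path. Without self-avoiding walks of [n]
    steps, all these paths are shorter than [n], since a prefix of a longer one would be such a
    walk; so only finitely many vertices are reached. *)
Lemma saw_tails_nonempty (v : T) (L : nat -> seq (seq T)) :
  connected_graph adj -> infinite_type T -> (forall n, saw_tails r v n (L n)) ->
  forall n, (0 < size (L n))%N.
Proof.
move=> conn inf L_saws n; rewrite lt0n; apply/negP => /nilP Ln0; apply: inf.
exists (map (last v) (flatten [seq L k | k <- iota 0 n])) => u; apply/InP.
have [s s_path <-] := connected_path conn v u.
case/shortenP: s_path => s' s'_path s'_uniq _; apply: map_f.
apply/flatten_mapP; exists (size s'); last first.
  by have [_ ->] := L_saws (size s'); rewrite eqxx s'_path.
rewrite mem_iota /= ltnNge; apply/negP => n_s'.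
suff : take n s' \in L n by rewrite Ln0.
have [_ ->] := L_saws n; rewrite size_takel // eqxx take_path //=.
by move: s'_uniq; rewrite -{1}(cat_take_drop n s') -cat_cons cat_uniq => /and3P[].
Qed.

End WalksAsPaths.

(** A walk starting in the image of [h] never leaves it. This transfers counts from the subtype of
    valid vertices to raw pairs. *)
Lemma saw_tails_embed (T T' : eqType) (r : rel T) (r' : rel T') (h : T -> T') (v : T) n L :
  injective h -> (forall a b, r' (h a) (h b) = r a b) ->
  (forall a b, r' (h a) b -> exists c, b = h c) ->
  saw_tails r v n L -> saw_tails r' (h v) n (map (map h) L).
Proof.
move=> h_inj h_adj h_closed [L_uniq memL]; split.
  by rewrite map_inj_uniq //; apply: inj_map.
have map_path s : path r' (h v) (map h s) = path r v s.
  by rewrite path_map; apply: eq_path => a b /=; rewrite h_adj.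
have mem_map_h s : map h s \in map (map h) L = (s \in L) by rewrite mem_map //; apply: inj_map.
move=> t; have [[s ->]|not_image] := pselect (exists s, t = map h s).
  by rewrite mem_map_h memL size_map map_path -map_cons map_inj_uniq.
have -> : t \in map (map h) L = false.
  by apply/negP => /mapP[s _ tE]; apply: not_image; exists s.
apply/esym/negP => /and3P[_ t_path _]; apply: not_image.
elim: t v t_path {map_path memL mem_map_h L_uniq L} => [|b t IHt] v /=; first by exists [::].
case/andP=> vb; have [c bE] := h_closed _ _ vb.
by rewrite bE => /IHt[s ->]; exists (c :: s).
Qed.

(** * Combining the two bounds *)

Section Assembly.
Local Open Scope ring_scope.

Lemma gadget_substitution
  (V : eqType) (adj : V -> V -> Prop) (col : V -> bool)
  (F1 F2 : finType) (e1 : rel F1) (e2 : rel F2)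
  (p1 : 'I_3 -> F1) (p2 : 'I_3 -> F2) (lab : V -> V -> 'I_3)
  (mu mut : R) :
  simple_graph adj -> infinite_type V -> connected_graph adj ->
  bipartite_colouring adj col -> cubic adj ->
  gadget e1 p1 -> gadget e2 p2 -> port_labelling adj lab ->
  connected_graph (tadj adj col e1 e2 p1 p2 lab) ->
  connective_constant adj mu ->
  connective_constant (tadj adj col e1 e2 p1 p2 lab) mut ->
  Rinv (pow mu 2) =
    Rmult (gadget_series e1 p1 (Rinv mut)) (gadget_series e2 p2 (Rinv mut)).
Proof.
move=> [adj_sym0 _] V_inf V_conn V_bip V_cubic gad1 gad2 lab_ok T_conn mu_conn mut_conn.
pose r : rel V := fun u v => `[< adj u v >].
have adjP u v : reflect (adj u v) (r u v) by apply: asboolP.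
pose T : eqType := {x : V * (F1 + F2) | tvert_ok col x}.
pose P (c : bool) (i : 'I_3) : F1 + F2 := if c then inl (p1 i) else inr (p2 i).
pose E : rel (F1 + F2)%type := gadget_adj e1 e2.
pose rt := radj r col lab E P.
pose tadj' (a b : T) := rt (val a) (val b).
have tadjP a b : reflect (tadj adj col e1 e2 p1 p2 lab a b) (tadj' a b).
  case: a b => -[v x] vx [[w y] wy]; rewrite /tadj' /rt /radj /tadj /=.
  apply: (iffP orP) => [[/andP[/eqP vw xy]|/and3P[/adjP vw /eqP xP /eqP yP]]
    |[[vw xy]|[vw [xP yP]]]]; [by left | by right | |].
  - by left; rewrite vw eqxx.
  - by right; apply/and3P; split; [apply/adjP | apply/eqP | apply/eqP].
have ok_port v i : tvert_ok col (v, P (col v) i) by rewrite /tvert_ok /P /=; case: (col v).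
have rt_closed (a : T) b : rt (val a) b -> exists c : T, b = val c.
  suff b_ok : rt (val a) b -> tvert_ok col b by move=> /b_ok ok; exists (Sub b ok).
  case: a b => -[v x] vx [w y]; rewrite /rt /radj /= => /orP[/andP[/eqP <-]|].
    by move: vx; rewrite /tvert_ok /E; case: (x) (y) => [a|a] [b|b].
  by case/and3P=> _ _ /eqP->; apply: ok_port.
have T_inf : infinite_type T.
  move=> [l l_all]; apply: V_inf; exists (map (fun a : T => (val a).1) l) => v.
  by apply/InP/mapP; exists (Sub (v, P (col v) ord0) (ok_port _ _)) => //; apply/InP.
have /choice[LG LG_P] := connective_constant_tails adjP mu_conn.
have /choice[LT LT_P] := connective_constant_tails tadjP mut_conn.
have LG_gt0 v n : (0 < size (LG v n))%N.
  by apply: (saw_tails_nonempty adjP V_conn V_inf); case: (LG_P v).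
have LT_gt0 a n : (0 < size (LT a n))%N.
  by apply: (saw_tails_nonempty tadjP T_conn T_inf); case: (LT_P a).
have [v0] : exists v0 : V, True.
  by apply: contrapT => noV; apply: V_inf; exists [::] => v; apply: noV; exists v.
move=> _; have mu_gt0 := root_limit_gt0 (LG_P v0).2 (LG_gt0 v0).
pose port i : T := Sub (v0, P (col v0) i) (ok_port _ _).
have mut_gt0 := root_limit_gt0 (LT_P (port ord0)).2 (LT_gt0 (port ord0)).
have r_sym : symmetric r by move=> u v; apply/adjP/adjP; apply: adj_sym0.
have r_col u v : r u v -> col v = ~~ col u.
  by move/adjP/V_bip; case: (col u); case: (col v).
have lab_inj v u w : r v u -> r v w -> lab v u = lab v w -> u = w.
  by move=> /adjP vu /adjP vw; apply: lab_ok.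
have /choice[nbr nbrP] v : exists s, size s = 3 /\ forall w, r v w = (w \in s).
  have [a [b [c [_ [_ [_ abc]]]]]] := V_cubic v; exists [:: a; b; c]; split=> // w.
  apply/adjP/idP => [/abc|]; rewrite !inE.
    by case=> [|[]] ->; rewrite eqxx ?orbT.
  by move=> /or3P[] /eqP-> ; apply/abc; [left | right; left | right; right].
have mem_nbr v w : (w \in nbr v) = r v w by case: (nbrP v) => _ ->.
have size_nbr v : size (nbr v) = 3 by case: (nbrP v).
pose g x (c : bool) := if c then gadget_series e1 p1 x else gadget_series e2 p2 x.
have sum_E x c i j : i != j -> \sum_(q <- gadget_paths E (P c) i j) x ^+ size q = g x c.
  move=> ij; rewrite /g; case: c.
    rewrite -(path_sum_series e1) -(path_sum_ports x gad1 ij).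
    apply: (path_sum_embed x (h := inl)) => // [a b []|a [b|b]] //; by exists b.
  rewrite -(path_sum_series e2) -(path_sum_ports x gad2 ij).
  apply: (path_sum_embed x (h := inr)) => // [a b []|a [b|b]] //; by exists b.
have g_ge0 x c : 0 <= x -> 0 <= g x c.
  move=> x_ge0; rewrite -(sum_E x c ord0 ord_max) //.
  by apply: sumr_ge0 => q _; rewrite exprn_ge0.
have LT_raw a n : saw_tails rt (val a) n (map (map val) (LT a n)).
  exact: (saw_tails_embed (r := tadj') val_inj _ (@rt_closed) ((LT_P a).1 n)).
rewrite (critical_point_eq (f := fun x => g x true * g x false) _ mu_gt0 mut_gt0) //.
- by apply: continuity_mult; apply: continuity_gadget_series.
- by move=> x /RltP/ltW x_ge0; apply/RleP; rewrite mulr_ge0 ?g_ge0.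
(* For [x < 1 / mut] the walk series from the three ports at [v0] converge, and they bound the terms
   of the base series at [y]. *)
- move=> x y /RltP x_gt0 /RltP xm /RltP y_gt0 /RleP; rewrite RpowE => y_le.
  have gx_ge0 c' : 0 <= g x c' by apply/g_ge0/ltW.
  have [D D_gt0 D_le] := alt_weight_lower y_gt0 gx_ge0 y_le.
  have /choice[B B_le] i : exists B, forall N,
      \sum_(0 <= n < N) (size (LT (port i) n))%:R * x ^+ n <= B.
    exact: (root_limit_sum_bound (LT_P _).2).
  pose bound := x * \sum_(i < 3) B i.
  (* Walks of [m.+1] steps come with the weight [D * y ^+ m * x ^+ 2]; dividing by [y] restores the
     exponent [m.+1]. *)
  have C_gt0 : 0 < D * x ^+ 2 / y by rewrite divr_gt0 ?mulr_gt0 ?exprn_gt0.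
  apply/RleP; apply: (root_limit_le1 (LG_P v0).2 (LG_gt0 v0) y_gt0 C_gt0
    (B := bound)) => m.
  have [N N_le] := saw_lower_bound r_sym r_col lab_inj (ltW x_gt0) (sum_E x)
    ((LG_P v0).1 m.+1) (fun i => LT_raw (port i)).
  apply: (le_trans _ (le_trans N_le _)); last first.
    rewrite /bound mulr_sumr; apply: ler_sum => i _; apply: le_trans (ler_wpM2l (ltW x_gt0) (B_le i N)).
    rewrite mulr_sumr; apply: ler_sum => n _.
    by rewrite size_map exprS mulrCA.
  rewrite ler_wpM2l // (exprS y) mulrA divfK ?gt_eqF // mulrAC ler_wpM2r ?D_le //.
  by rewrite exprn_ge0 // ltW.
(* For [y < 1 / mu] the base series converges at [y] from every neighbour of [v0], and this bounds
   the terms of the transformed series at [x]. *)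
- move=> x y /RltP x_gt0 /RltP y_gt0 /RleP; rewrite RpowE => y_ge /RltP mu_y.
  have gx_ge0 c' : 0 <= g x c' by apply/g_ge0/ltW.
  have [D D_gt0 D_le] := alt_weight_upper y_gt0 gx_ge0 y_ge.
  have /choice[B B_le] v : exists B, forall N,
      \sum_(0 <= n < N) (size (LG v n))%:R * y ^+ n <= B.
    by apply: (root_limit_sum_bound (LG_P _).2) => //; rewrite mulrC.
  pose a0 := port ord0; pose S := short_sum (F1 + F2)%type x.
  pose bound := S * (S * (3%:R * S)) * \sum_(v <- nbr v0) D * B v.
  have S_ge0 : 0 <= S by apply/short_sum_ge0/ltW.
  (* The constant [M] is [x], for the starting vertex: a walk of [n.+1] steps visits [n.+2]
     vertices. *)
  apply/RleP; apply: (root_limit_le1 (LT_P a0).2 (LT_gt0 a0) x_gt0 x_gt0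
    (B := bound)) => n.
  have upper := saw_upper_bound r_sym r_col lab_inj (ltW x_gt0) (sum_E x) mem_nbr size_nbr
    (LT_raw a0 n.+1) (fun v => (LG_P v).1).
  rewrite -exprS; move: upper; rewrite size_map => /le_trans; apply.
  rewrite /bound ler_wpM2l ?mulr_ge0 //; apply: ler_sum => v _.
  apply: le_trans (ler_wpM2l (ltW D_gt0) (B_le v n.+2)).
  rewrite mulr_sumr; apply: ler_sum => k _.
  by rewrite mulrCA ler_wpM2l.
Qed.

End Assembly.

Theorem theorem3p5
  (V : Type) (adj : V -> V -> Prop) (col : V -> bool)
  (F1 F2 : finType) (e1 : rel F1) (e2 : rel F2)
  (p1 : 'I_3 -> F1) (p2 : 'I_3 -> F2) (lab : V -> V -> 'I_3)
  (mu mut : R) :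
  simple_graph adj -> infinite_type V -> connected_graph adj ->
  bipartite_colouring adj col -> coloured_quasi_transitive adj col ->
  cubic adj ->
  gadget e1 p1 -> gadget e2 p2 -> port_labelling adj lab ->
  connected_graph (tadj adj col e1 e2 p1 p2 lab) ->
  connective_constant adj mu ->
  connective_constant (tadj adj col e1 e2 p1 p2 lab) mut ->
  Rinv (pow mu 2) =
    Rmult (gadget_series e1 p1 (Rinv mut)) (gadget_series e2 p2 (Rinv mut)).
Proof.
move=> V_simple V_inf V_conn V_bip _.
(* The alias [{classic V}] equips [V] with a classical decidable equality. *)
exact: (@gadget_substitution {classic V} adj col F1 F2 e1 e2 p1 p2 lab mu mut).
Qed.
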